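(* For every network graph $G=(V,E)$ and every local dimension $d\ge2$, the operator $$W_{\mathcal{B}(G)}=-\bigotimes_{e\in E}\Phi_e+\sum_{\emptyset\ne K\in\mathcal{B}(G)}\ \bigotimes_{e\in K}\frac{\mathbb{I}_e-\Phi_e}{d-1}\otimes\bigotimes_{e\in E\setminus K}\Phi_e$$ is a sub-symmetric witness (SSW) for $G$, where $\mathcal{B}(G)$ is the cut space of $G$.
   Context: Network: $G=(V,E)$ is a finite connected simple undirected graph with $|V|\ge2$; vertices are parties. To each edge $e=\{u,v\}$ is attached $\mathcal{H}_e=\mathbb{C}^d\otimes\mathbb{C}^d$, one tensor factor held by $u$ and the other by $v$; the network Hilbert space is $\bigotimes_{e\in E}\mathcal{H}_e$, and each party $v$ holds all factors located at $v$. $\mathbb{I}_e$ is the identity on $\mathcal{H}_e$ and $\Phi_e=|\phi^+\rangle\langle\phi^+|$ with $|\phi^+\rangle=\frac1{\sqrt d}\sum_{i=0}^{d-1}|ii\rangle$. For $S\subseteq V$ with $S\ne\emptyset,V$ (nontrivial), $\Gamma_S$ denotes the partial transpose (computational basis) on all tensor factors held by parties in $S$. A Hermitian operator $W$ is fully decomposable if for every nontrivial $S\subseteq V$ there exist positive semidefinite $P_S,Q_S$ with $W=P_S+Q_S^{\Gamma_S}$. A sub-symmetric witness (SSW) for $G$ is a fully decomposable operator of the form $\sum_{T\subseteq E}w_T\bigotimes_{e\in T}\Phi_e\otimes\bigotimes_{e\notin T}(\mathbb{I}_e-\Phi_e)$ with $w_T\in\mathbb{R}$. For nontrivial $S$,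 the cut $T(S)\subseteq E$ is the set of edges with exactly one endpoint in $S$; the cut space $\mathcal{B}(G)$ is the set consisting of $\emptyset$ and all cuts $T(S)$. *)

(* Defs.v *)
From mathcomp Require Import all_boot all_order all_algebra.
From mathcomp Require Import sesquilinear spectral.
From mathcomp Require Import reals complex.

Set Implicit Arguments.
Unset Strict Implicit.
Unset Printing Implicit Defensive.

Import Order.TTheory GRing.Theory Num.Theory.
Local Open Scope ring_scope.
Local Open Scope sesquilinear_scope.

(* A graph on V is given by its edge set E, a set of 2-element subsets of V. *)
Notation edge E := {e : {set _} | e \in E}.

Section Graph.
Variables (V : finType) (E : {set {set V}}).

Definition simple_graph : Prop := {in E, forall e : {set V}, #|e| = 2%N}.

(* For a simple graph, [set u; v] \in E forces u != v. *)
Definition adjacent : rel V := fun u v => [set u; v] \in E.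

Definition connected_graph : Prop := forall u v : V, connect adjacent u v.

Definition nontrivial (S : {set V}) : bool := (S != set0) && (S != setT).

Definition cut (S : {set V}) : {set edge E} :=
  [set e : edge E | #|val e :&: S| == 1%N].

Definition cut_space : {set {set edge E}} :=
  set0 |: [set cut S | S : {set V} & nontrivial S].

End Graph.

(* An operator on the Hilbert space with orthonormal basis indexed by a finite *)
(* type I is a square matrix of size #|I|, through the enumeration of I.       *)
Section Operators.
Variables (R : realType) (I : finType).
Local Notation C := R[i].

Definition ket (x : I) : 'cV[C]_#|I| := delta_mx (enum_rank x) 0.

Definition ketbra (u : 'cV[C]_#|I|) : 'M[C]_#|I| := u *m u ^t*.

(* In R[i], 0 <= z means that z is real and nonnegative. *)
Definition psd (A : 'M[C]_#|I|) : Prop :=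
  A \is hermsymmx /\ forall u : 'cV[C]_#|I|, 0 <= (u ^t* *m A *m u) 0 0.

End Operators.

Section Network.
Variables (R : realType) (V : finType) (E : {set {set V}}) (d : nat).
Local Notation C := R[i].

(* The basis of H_e = C^d (x) C^d, with its two tensor factors labelled by the *)
(* endpoints of e, i.e. by the parties holding them.                           *)
Definition edge_basis (e : edge E) : finType :=
  {ffun {v : V | v \in val e} -> 'I_d}.

Definition net_basis : finType := {dffun forall e : edge E, edge_basis e}.

Definition tensor (A : forall e : edge E, 'M[C]_#|edge_basis e|) : 'M[C]_#|net_basis| :=
  \matrix_(i, j) \prod_(e : edge E)
    A e (enum_rank ((enum_val i : net_basis) e))
        (enum_rank ((enum_val j : net_basis) e)).

(* The constant function i is the basis vector |ii> of H_e. *)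
Definition phi_plus (e : edge E) : 'cV[C]_#|edge_basis e| :=
  (sqrtC d%:R)^-1 *: \sum_(i < d) ket R ([ffun=> i] : edge_basis e).

Definition Phi (e : edge E) : 'M[C]_#|edge_basis e| := ketbra (phi_plus e).

(* The basis label x, with the labels held by the parties in S taken from y. *)
Definition mix (S : {set V}) (x y : net_basis) : net_basis :=
  [ffun e : edge E =>
    ([ffun v => if val v \in S then y e v else x e v] : edge_basis e)].

Definition partial_transpose (S : {set V}) (A : 'M[C]_#|net_basis|) :
    'M[C]_#|net_basis| :=
  \matrix_(i, j)
    A (enum_rank (mix S (enum_val i) (enum_val j)))
      (enum_rank (mix S (enum_val j) (enum_val i))).

Definition fully_decomposable (W : 'M[C]_#|net_basis|) : Prop :=
  W \is hermsymmx /\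
  forall S : {set V}, nontrivial S ->
    exists P Q : 'M[C]_#|net_basis|,
      [/\ psd P, psd Q & W = P + partial_transpose S Q].

Definition sub_symmetric_form (W : 'M[C]_#|net_basis|) : Prop :=
  exists w : {set edge E} -> R,
    W = \sum_(T : {set edge E}) (w T)%:C%C *:
          tensor (fun e => if e \in T then Phi e else 1%:M - Phi e).

Definition is_SSW (W : 'M[C]_#|net_basis|) : Prop :=
  fully_decomposable W /\ sub_symmetric_form W.

Definition W_cut : 'M[C]_#|net_basis| :=
  - tensor (fun e => Phi e)
  + \sum_(K in cut_space E | K != set0)
      tensor (fun e => if e \in K then (d%:R - 1)^-1 *: (1%:M - Phi e)
                       else Phi e).

End Network.

(* Main.v *)
(* For nontrivial S the cut K = T(S) is nonempty, as G is connected, so its    *)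
(* term is present in W. All other positive terms of W form a positive         *)
(* semidefinite P_S, and what remains is (term of K) - (tensor of the Phi_e),  *)
(* which is positive semidefinite after the partial transpose on S: off the    *)
(* cut the two products have the same factors Phi_e, invariant under           *)
(* transposition, while on a cut edge the factors B = Phi_e^G = F_e / d and    *)
(* A = ((1 - Phi_e) / (d - 1))^G, with F_e the swap, are simultaneously        *)
(* diagonalizable with |B| <= A, so that the product of the B's is dominated   *)
(* by the product of the A's. Only the cuts matter, not the fact that they     *)
(* form a vector space.                                                        *)

Require Import Defs.
From mathcomp Require Import all_boot all_order all_algebra reals complex.
From mathcomp Require Import sesquilinear ring.

Set Implicit Arguments.
Unset Strict Implicit.
Unset Printing Implicit Defensive.

Import Order.TTheory GRing.Theory Num.Theory.
Local Open Scope ring_scope.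
Local Open Scope sesquilinear_scope.

(** For each bipartition S, the negative term of W has to be absorbed, after partial transposition
    on S, by positive terms; the single term of the cut of S suffices. All operators involved are
    products over the edges, and so are their partial transposes ([partial_transpose_tensor]), which
    reduces the comparison to one edge. There the two transposed factors are combinations r1 p + r2
    q and s1 p + s2 q of the same projectors, with |s1| <= r1 and |s2| <= r2
    ([edge_transpose_domination]). Expanding both products over the choice of p or q on every edge
    gives the same product projectors with nonnegative differences of coefficients ([psd_tensorB]).
    Connectivity enters through [cut_neq0]: the required term does occur in W. The other terms are
    nonnegative multiples of projectors and form P. *)

(** * Positive semidefinite operators and projectors *)

Section FiniteOperators.
Variables (R : realType) (I : finType).
Local Notation C := R[i].
Implicit Types (A B M P F : 'M[C]_#|I|) (x y : I).

Lemma mx_rankP A B :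
  (forall x y, A (enum_rank x) (enum_rank y) = B (enum_rank x) (enum_rank y)) ->
  A = B.
Proof.
by move=> eqAB; apply/matrixP=> i j; rewrite -(enum_valK i) -(enum_valK j) eqAB.
Qed.

Lemma mulmx_rankE A B x y :
  (A *m B) (enum_rank x) (enum_rank y) =
  \sum_z A (enum_rank x) (enum_rank z) * B (enum_rank z) (enum_rank y).
Proof.
by rewrite mxE (reindex (@enum_rank I)) //; apply/onW_bij/enum_rank_bij.
Qed.

Lemma scalar_mx_rankE (c : C) x y :
  (c%:M : 'M[C]_#|I|) (enum_rank x) (enum_rank y) = c *+ (x == y).
Proof. by rewrite mxE (inj_eq enum_rank_inj). Qed.

Lemma adjmxM m n p (A : 'M[C]_(m, n)) (B : 'M[C]_(n, p)) :
  (A *m B)^t* = B^t* *m A^t*.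
Proof. by rewrite trmx_mul map_mxM. Qed.

Lemma adjmxK m n (A : 'M[C]_(m, n)) : (A^t*)^t* = A.
Proof. by apply/matrixP=> i j; rewrite !mxE conjCK. Qed.

Lemma adjmxD m n (A B : 'M[C]_(m, n)) : (A + B)^t* = A^t* + B^t*.
Proof. by rewrite linearD map_mxD. Qed.

Lemma adjmxN m n (A : 'M[C]_(m, n)) : (- A)^t* = - A^t*.
Proof. by rewrite linearN map_mxN. Qed.

Lemma adjmxZ m n (c : C) (A : 'M[C]_(m, n)) :
  c \is Num.real -> (c *: A)^t* = c *: A^t*.
Proof. by move=> c_real; rewrite linearZ map_mxZ /= conj_Creal. Qed.

Lemma adjmx1 n : (1%:M : 'M[C]_n)^t* = 1%:M.
Proof. by rewrite trmx1 map_mx1. Qed.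

Lemma hermsymmxE A : (A \is hermsymmx) = (A^t* == A).
Proof. by rewrite is_hermitianmxE expr0 scale1r eq_sym. Qed.

Lemma psd_gram M : psd (M^t* *m M).
Proof.
split=> [|u]; first by rewrite hermsymmxE adjmxM adjmxK.
rewrite mulmxA -adjmxM -mulmxA mxE sumr_ge0 // => k _.
by rewrite !mxE mulrC mul_conjC_ge0.
Qed.

Lemma psd0 : psd (0 : 'M[C]_#|I|).
Proof. by have := psd_gram (0 : 'M[C]_#|I|); rewrite mulmx0. Qed.

Lemma psdD A B : psd A -> psd B -> psd (A + B).
Proof.
case=> hA pA [hB pB]; split=> [|u].
  by move: hA hB; rewrite !hermsymmxE adjmxD => /eqP-> /eqP->.
by rewrite mulmxDr mulmxDl mxE addr_ge0.
Qed.

Lemma psdZ (c : C) A : 0 <= c -> psd A -> psd (c *: A).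
Proof.
move=> c_ge0 [hA pA]; split=> [|u].
  by move: hA; rewrite !hermsymmxE adjmxZ ?ger0_real // => /eqP->.
by rewrite -scalemxAr -scalemxAl mxE mulr_ge0.
Qed.

Lemma psd_sum (J : finType) (Q : pred J) (A : J -> 'M[C]_#|I|) :
  (forall j, Q j -> psd (A j)) -> psd (\sum_(j | Q j) A j).
Proof. exact: (big_ind (@psd R I) psd0 psdD). Qed.

Definition projector P := P^t* = P /\ P *m P = P.

Lemma psd_projector P : projector P -> psd P.
Proof. by case=> hP idP; rewrite -idP -{1}hP; apply: psd_gram. Qed.

Lemma projectorC P : projector P -> projector (1%:M - P).
Proof.
case=> hP idP; split; first by rewrite adjmxD adjmxN adjmx1 hP.
by rewrite mulmxBr mulmx1 mulmxBl mul1mx idP subrr subr0.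
Qed.

(** This is the spectral projector of F for the eigenvalue 1; applied to F and -F, with F the swap,
    it gives the symmetric and antisymmetric subspaces. *)
Lemma projector_involution F :
  F^t* = F -> F *m F = 1%:M -> projector (2^-1 *: (1%:M + F)).
Proof.
move=> hF invF; split; first by rewrite adjmxZ ?adjmxD ?adjmx1 ?hF ?rpredV ?realn.
rewrite -scalemxAl -scalemxAr mulmxDl mul1mx mulmxDr mulmx1 invF [F + _]addrC.
rewrite -mulr2n -[(_ + F) *+ 2]scaler_nat !scalerA.
by rewrite -mulrA mulVf ?mulr1 ?pnatr_eq0.
Qed.

End FiniteOperators.

(** * Products over the edges *)

Section Tensor.
Variables (R : realType) (V : finType) (E : {set {set V}}) (d : nat).
Local Notation C := R[i].
Local Notation basis := (edge_basis d).
Local Notation netb := (net_basis E d).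
Local Notation op := (forall e : edge E, 'M[C]_#|basis e|).
Implicit Types (A B p q : op) (x y : netb).

Lemma tensorE A x y :
  tensor A (enum_rank x) (enum_rank y) =
  \prod_e A e (enum_rank (x e)) (enum_rank (y e)).
Proof. by rewrite mxE !enum_rankK. Qed.

Lemma eq_tensor A B : (forall e, A e = B e) -> tensor A = tensor B.
Proof.
by move=> eqAB; apply: mx_rankP=> x y; rewrite !tensorE; apply: eq_bigr=> e _; rewrite eqAB.
Qed.

Lemma tensor_adj A : (tensor A)^t* = tensor (fun e => (A e)^t*).
Proof.
apply: mx_rankP=> x y; rewrite !mxE rmorph_prod !enum_rankK.
by apply: eq_bigr=> e _; rewrite !mxE.
Qed.

Lemma prod_sum_dffun (F : forall e : edge E, basis e -> C) :
  \prod_e \sum_(z : basis e) F e z = \sum_(z : netb) \prod_e F e (z e).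
Proof.
(* The type of labels depends on the edge, so distributivity is applied to functions into the tagged
   union of these types; [untag] extends each F e by 0 outside its own fibre. *)
rewrite (reindex (@dffun_of_fprod _ _)) /=; last first.
  exact/onW_bij/(Bijective (@dffun_of_fprodK _ _) (@fprod_of_dffunK _ _)).
under [RHS]eq_bigr => t _ do
  under eq_bigr => e _ do rewrite ffunE -[F e _](ffunE (F e)).
rewrite (big_fprod 1 +%R (fun e => [ffun z => F e z])) /=.
rewrite -(bigA_distr_big_dep _ (fun e g => untag 0 [ffun z => F e z] g)) /=.
apply: eq_bigr=> e _; transitivity (\sum_z [ffun z => F e z] z).
  by apply: eq_bigr=> z _; rewrite ffunE.
exact: (big_tag (T_ := basis) (fun e : edge E => [ffun z => F e z]) e).
Qed.

Lemma tensor_mul A B : tensor A *m tensor B = tensor (fun e => A e *m B e).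
Proof.
apply: mx_rankP=> x y; rewrite mulmx_rankE tensorE.
under [RHS]eq_bigr do rewrite mulmx_rankE.
rewrite prod_sum_dffun; apply: eq_bigr=> z _.
by rewrite !tensorE -big_split.
Qed.

Lemma tensorZ (c : edge E -> C) A :
  tensor (fun e => c e *: A e) = (\prod_e c e) *: tensor A.
Proof.
apply: mx_rankP=> x y; rewrite tensorE mxE tensorE -big_split.
by apply: eq_bigr=> e _; rewrite mxE.
Qed.

Lemma tensorD A B :
  tensor (fun e => A e + B e) =
  \sum_(J : {set edge E}) tensor (fun e => if e \in J then A e else B e).
Proof.
apply: mx_rankP=> x y; rewrite tensorE summxE.
under eq_bigr do rewrite mxE.
rewrite bigA_distr; apply: eq_bigr=> J _; rewrite tensorE.
by apply: eq_bigr=> e _; case: ifP.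
Qed.

Lemma tensor_projector A :
  (forall e, projector (A e)) -> projector (tensor A).
Proof.
move=> projA; split; first by rewrite tensor_adj; apply: eq_tensor=> e; case: (projA e).
by rewrite tensor_mul; apply: eq_tensor=> e; case: (projA e).
Qed.

Lemma psd_tensorB p q (a b g h : edge E -> C) :
    (forall e, projector (p e)) -> (forall e, projector (q e)) ->
    (forall e, g e \is Num.real) -> (forall e, h e \is Num.real) ->
    (forall e, `|g e| <= a e) -> (forall e, `|h e| <= b e) ->
  psd (tensor (fun e => a e *: p e + b e *: q e)
       - tensor (fun e => g e *: p e + h e *: q e)).
Proof.
move=> projp projq g_real h_real le_ga le_hb.
have expand (r s : edge E -> C) : tensor (fun e => r e *: p e + s e *: q e) =
    \sum_(J : {set edge E}) (\prod_e (if e \in J then r e else s e)) *: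
       tensor (fun e => if e \in J then p e else q e).
  rewrite tensorD; apply: eq_bigr=> J _; rewrite -tensorZ.
  by apply: eq_tensor=> e; case: ifP.
rewrite !expand -sumrB; apply: psd_sum=> J _; rewrite -scalerBl.
apply: psdZ; last first.
  by apply/psd_projector/tensor_projector=> e; case: ifP.
(* The product of the g's and h's may have either sign; being real, it is at most its absolute
   value, which is bounded factor by factor. *)
rewrite subr_ge0 (le_trans (real_ler_norm _)) //.
  by apply: rpred_prod=> e _; case: ifP.
rewrite normr_prod; apply: ler_prod=> e _.
by rewrite normr_ge0 /=; case: ifP.
Qed.

End Tensor.

(** * Partial transposition, edge by edge *)

Section PartialTranspose.
Variables (R : realType) (V : finType) (E : {set {set V}}) (d : nat).
Local Notation C := R[i].
Local Notation basis := (edge_basis d).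
Local Notation netb := (net_basis E d).
Variable S : {set V}.

Lemma mixK (x y : netb) : mix S (mix S x y) (mix S y x) = x.
Proof.
by apply/ffunP=> e; apply/ffunP=> v; rewrite !ffunE /=; case: (_ \in S).
Qed.

Lemma partial_transposeK : involutive (@partial_transpose R V E d S).
Proof.
by move=> A; apply: mx_rankP=> x y; rewrite !mxE !enum_rankK !mixK.
Qed.

Definition edge_mix (e : edge E) (x y : basis e) : basis e :=
  [ffun v => if val v \in S then y v else x v].

Definition edge_transpose (e : edge E) (A : 'M[C]_#|basis e|) : 'M[C]_#|basis e| :=
  \matrix_(i, j) A (enum_rank (edge_mix (enum_val i) (enum_val j)))
                   (enum_rank (edge_mix (enum_val j) (enum_val i))).

Lemma partial_transposeB (A B : 'M[C]_#|netb|) :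
  partial_transpose S (A - B) = partial_transpose S A - partial_transpose S B.
Proof. by apply/matrixP=> i j; rewrite !mxE. Qed.

Lemma partial_transpose_tensor (A : forall e : edge E, 'M[C]_#|basis e|) :
  partial_transpose S (tensor A) = tensor (fun e => edge_transpose (A e)).
Proof.
apply: mx_rankP=> x y; rewrite mxE !tensorE !enum_rankK.
by apply: eq_bigr=> e _; rewrite mxE !enum_rankK !ffunE.
Qed.

Lemma edge_transposeB (e : edge E) (A B : 'M[C]_#|basis e|) :
  edge_transpose (A - B) = edge_transpose A - edge_transpose B.
Proof. by apply/matrixP=> i j; rewrite !mxE. Qed.

Lemma edge_transposeZ (e : edge E) c (A : 'M[C]_#|basis e|) :
  edge_transpose (c *: A) = c *: edge_transpose A.
Proof. by apply/matrixP=> i j; rewrite !mxE. Qed.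

Lemma edge_transpose1 (e : edge E) : edge_transpose (1%:M : 'M[C]_#|basis e|) = 1%:M.
Proof.
apply: mx_rankP=> x y; rewrite mxE !scalar_mx_rankE !enum_rankK; congr (_ *+ nat_of_bool _).
apply/eqP/eqP=> [/ffunP eq_mix|-> //]; apply/ffunP=> v.
by move: (eq_mix v); rewrite !ffunE; case: ifP.
Qed.

End PartialTranspose.

(** * The comparison on a single edge *)

Section Edge.
Variables (R : realType) (V : finType) (E : {set {set V}}) (d : nat).
Hypotheses (simpleE : simple_graph E) (d_ge2 : (2 <= d)%N).
Local Notation C := R[i].
Variable e : edge E.
Local Notation basis := (edge_basis d e).
Local Notation endpoint := {v : V | v \in val e}.
Implicit Types (x y z : basis).

(** The coefficient at x of the unnormalized vector sum of the |ii>. As e has an endpoint, distinct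
    i give distinct constant labels, so this is the indicator of constant labels. *)
Definition diag_weight x : C := \sum_(i < d) (x == [ffun=> i])%:R.

Lemma Phi_rankE x y :
  Phi R d e (enum_rank x) (enum_rank y) = d%:R^-1 * (diag_weight x * diag_weight y).
Proof.
have phi_plusE z : phi_plus R d e (enum_rank z) 0 = (sqrtC d%:R)^-1 * diag_weight z.
  rewrite mxE summxE; congr (_ * _); apply: eq_bigr=> i _.
  by rewrite mxE (inj_eq enum_rank_inj) andbT.
transitivity (phi_plus R d e (enum_rank x) 0 * (phi_plus R d e (enum_rank y) 0)^*).
  by rewrite mxE big_ord1; congr (_ * _); rewrite 2!mxE.
rewrite !phi_plusE rmorphM fmorphV /=.
rewrite (conj_Creal (ger0_real _)) ?sqrtC_ge0 ?ler0n //.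
have -> : (diag_weight y)^* = diag_weight y.
  by rewrite rmorph_sum; apply: eq_bigr=> i _; rewrite rmorph_nat.
by rewrite mulrACA -invfM -expr2 sqrtCK.
Qed.

Lemma trmx_Phi : (Phi R d e)^T = Phi R d e.
Proof. by apply: mx_rankP=> x y; rewrite mxE !Phi_rankE [X in _ * X]mulrC. Qed.

Lemma Phi_adj : (Phi R d e)^t* = Phi R d e.
Proof. by rewrite /Phi /ketbra adjmxM adjmxK. Qed.

Lemma edge_nonempty : endpoint.
Proof.
have /set0Pn/sigW[v ve] : val e != set0 by rewrite -card_gt0 (simpleE (valP e)).
by exists v.
Qed.

Lemma diag_weight_const (i : 'I_d) : diag_weight [ffun=> i] = 1.
Proof.
rewrite /diag_weight (bigD1 i) //= eqxx big1 ?addr0 // => j /negPf ne_ji.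
suff -> : ([ffun=> i] == [ffun=> j] :> basis) = false by [].
by apply/negP=> /eqP/ffunP/(_ edge_nonempty)/eqP; rewrite !ffunE eq_sym ne_ji.
Qed.

Lemma sum_diag_weight2 : \sum_x diag_weight x * diag_weight x = d%:R.
Proof.
under eq_bigr => x _ do rewrite {1}/diag_weight mulr_suml.
transitivity (\sum_(i < d) 1 : C); last by rewrite sumr_const card_ord.
rewrite exchange_big /=; apply: eq_bigr=> i _.
rewrite (bigD1 [ffun=> i]) //= eqxx mul1r diag_weight_const big1 ?addr0 //.
by move=> x /negPf->; rewrite mul0r.
Qed.

Lemma Phi_projector : projector (Phi R d e).
Proof.
split; first exact: Phi_adj.
apply: mx_rankP=> x y; rewrite mulmx_rankE Phi_rankE.
have d_neq0 : d%:R != 0 :> C by rewrite pnatr_eq0 -lt0n (ltn_trans _ d_ge2).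
transitivity (d%:R^-1 * d%:R^-1 * (diag_weight x * diag_weight y) *
   \sum_z diag_weight z * diag_weight z).
  rewrite mulr_sumr; apply: eq_bigr=> z _.
  rewrite !Phi_rankE mulrACA -[RHS]mulrA; congr (_ * _).
  by rewrite [diag_weight z * diag_weight y]mulrC mulrACA.
by rewrite sum_diag_weight2 mulrAC mulfVK.
Qed.

Variable S : {set V}.

(** Either no endpoint or both endpoints of e lie in S, so the transposition is trivial or full, and
    Phi is a symmetric matrix. *)
Lemma Phi_transpose_noncut :
  e \notin cut E S -> edge_transpose S (Phi R d e) = Phi R d e.
Proof.
rewrite inE => ncut.
have [b Sb] : exists b, forall v : endpoint, (val v \in S) = b.
  have := cardsID S (val e); rewrite (simpleE (valP e)).
  case cS: #|_ :&: _| ncut => [|[|k]] // _.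
    move=> _; exists false=> v; move/eqP: cS; rewrite cards_eq0 => /eqP/setP/(_ (val v)).
    by rewrite !inE (valP v).
  rewrite !addSn => -[/eqP]; rewrite addn_eq0 => /andP[_].
  rewrite cards_eq0 => /eqP/setP cD; exists true=> v; move: (cD (val v)).
  by rewrite !inE (valP v) andbT => /negbFE.
apply: mx_rankP=> x y; rewrite mxE !enum_rankK.
have -> z t : edge_mix S z t = if b then t else z :> basis.
  by apply/ffunP=> v; rewrite ffunE Sb; case: b {Sb}.
have -> z t : edge_mix S z t = if b then t else z :> basis.
  by apply/ffunP=> v; rewrite ffunE Sb; case: b {Sb}.
by case: b {Sb} => //; rewrite -[in LHS]trmx_Phi mxE.
Qed.

Lemma cut_endpoints : e \in cut E S ->
  exists u v : endpoint,
    [/\ val u \in S, val v \notin S & forall w : endpoint, w = u \/ w = v].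
Proof.
rewrite inE => /eqP cI; have := cardsID S (val e).
rewrite (simpleE (valP e)) cI => -[/eqP/cards1P[b eD]].
have /eqP/cards1P[a eI] := cI.
have /setIP[ae aS] : a \in val e :&: S by rewrite eI inE.
have /setDP[be bS] : b \in val e :\: S by rewrite eD inE.
exists (exist _ a ae), (exist _ b be); split=> // w.
have [wS|wS] := boolP (val w \in S); [left | right]; apply/val_inj=> /=.
  by apply/set1P; rewrite -eI inE wS (valP w).
by apply/set1P; rewrite -eD inE wS (valP w).
Qed.

(** F is the swap of the two tensor factors. Exchanging the labels of x and y at u makes both
    constant exactly when y is x with its two labels swapped. *)
Lemma Phi_transpose_cut : e \in cut E S ->
  exists F : 'M[C]_#|basis|,
    [/\ F^t* = F, F *m F = 1%:M & edge_transpose S (Phi R d e) = d%:R^-1 *: F].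
Proof.
case/cut_endpoints=> u [v [uS vS uvP]].
have ne_vu : (v == u) = false by apply/negP=> /eqP vu; rewrite vu uS in vS.
pose swap x : basis := [ffun w => if w == u then x v else x u].
have swapu x : swap x u = x v by rewrite ffunE eqxx.
have swapv x : swap x v = x u by rewrite ffunE ne_vu.
have basisP x y : (x == y) = (x u == y u) && (x v == y v).
  apply/eqP/andP=> [->|[/eqP xyu /eqP xyv]] //.
  by apply/ffunP=> w; case: (uvP w) => ->.
have diagE x : diag_weight x = (x u == x v)%:R.
  rewrite /diag_weight (bigD1 (x u)) //= big1 ?addr0 => [|i ne_i].
    by rewrite basisP !ffunE eqxx eq_sym.
  by rewrite basisP !ffunE eq_sym (negPf ne_i).
exists (\matrix_(i, j) (swap (enum_val i) == enum_val j)%:R); split.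
- apply: mx_rankP=> x y; rewrite !mxE !enum_rankK rmorph_nat; congr (nat_of_bool _)%:R.
  by rewrite !basisP !swapu !swapv andbC; congr (_ && _); rewrite eq_sym.
- apply: mx_rankP=> x y; rewrite mulmx_rankE scalar_mx_rankE.
  rewrite (bigD1 (swap x)) //= big1 ?addr0 => [|z ne_z]; last first.
    by rewrite !mxE !enum_rankK eq_sym (negPf ne_z) mul0r.
  rewrite !mxE !enum_rankK eqxx mul1r; congr (nat_of_bool _)%:R.
  by rewrite !basisP !(swapu, swapv).
- apply: mx_rankP=> x y; rewrite mxE Phi_rankE [RHS]mxE [X in _ = _ * X]mxE.
  rewrite !enum_rankK !diagE !ffunE.
  rewrite uS (negPf vS) -natrM mulnb; congr (_ * (nat_of_bool _)%:R).
  by rewrite !basisP swapu swapv eq_sym.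
Qed.

(* On a cut edge the partial transposes of both operators are diagonal in the  *)
(* symmetric and antisymmetric subspaces: the eigenvalues are 1/d, -1/d for    *)
(* Phi, and 1/d, (d+1)/(d(d-1)) for (1 - Phi)/(d-1).                           *)
Lemma edge_transpose_domination :
  exists pq : 'M[C]_#|basis| * 'M[C]_#|basis|, exists r : C * C, exists s : C * C,
  [/\ projector pq.1 /\ projector pq.2, s.1 \is Num.real /\ s.2 \is Num.real,
      `|s.1| <= r.1 /\ `|s.2| <= r.2,
      edge_transpose S (if e \in cut E S then (d%:R - 1)^-1 *: (1%:M - Phi R d e)
                        else Phi R d e) = r.1 *: pq.1 + r.2 *: pq.2
    & edge_transpose S (Phi R d e) = s.1 *: pq.1 + s.2 *: pq.2].
Proof.
case: ifPn => [/Phi_transpose_cut[F [hF invF PhiF]] | /Phi_transpose_noncut PhiS].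
  have d_gt0 : 0 < d%:R :> C by rewrite ltr0n (ltn_trans _ d_ge2).
  have d1_gt0 : 0 < d%:R - 1 :> C by rewrite subr_gt0 ltr1n.
  exists (2^-1 *: (1%:M + F), 2^-1 *: (1%:M - F)).
  exists (d%:R^-1, (d%:R - 1)^-1 * (1 + d%:R^-1)), (d%:R^-1, - d%:R^-1) => /=.
  split.
  - split; apply: projector_involution => //; first by rewrite adjmxN hF.
    by rewrite mulmxN mulNmx opprK.
  - by rewrite rpredN !rpredV !realn.
  - rewrite normrN ger0_norm ?invr_ge0 ?ler0n //; split=> //.
    (* Multiplied by d - 1, the antisymmetric bound reads 1 - 1/d <= 1 + 1/d. *)
    rewrite ler_pdivlMl // mulrBl divff ?gt_eqF // mul1r lerBlDr.
    by rewrite -addrA lerDl addr_ge0 // invr_ge0 ltW.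
  - rewrite edge_transposeZ edge_transposeB edge_transpose1 PhiF !scalerA.
    move: d%:R d_gt0 d1_gt0 (1%:M : 'M[C]_#|basis|) => D D_gt0 D1_gt0 Id.
    apply/matrixP=> i j; rewrite !mxE; field.
    by rewrite !gt_eqF ?ltr0n.
  - rewrite PhiF; move: d%:R d_gt0 (1%:M : 'M[C]_#|basis|) => D D_gt0 Id.
    apply/matrixP=> i j; rewrite !mxE; field.
    by rewrite !gt_eqF ?ltr0n.
(* Off the cut both factors are the same projector; pairing it with 0 gives all edges the same
   two-projector form. *)
exists (Phi R d e, 0), (1, 0), (1, 0) => /=; rewrite PhiS scale1r scaler0 addr0.
split=> //; last by rewrite normr1 normr0.
split=> /=; first exact: Phi_projector.
by split; rewrite ?mulmx0 // trmx0 map_mx0.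
Qed.

End Edge.

(** * Cuts of a connected graph *)

Lemma cut_neq0 (V : finType) (E : {set {set V}}) (S : {set V}) :
  connected_graph E -> nontrivial S -> cut E S != set0.
Proof.
move=> connE /andP[/set0Pn[u uS] SnT].
have [v vS] : exists v, v \notin S.
  by apply/existsP; rewrite -negb_forall; apply: contra SnT => /forallP allS;
     apply/eqP/setP=> w; rewrite inE allS.
apply: contraNneq vS => cut0.
(* With an empty cut no edge leaves S, so S contains every vertex reachable from u, in particular
   v. *)
suff clS : closed (adjacent E) S by rewrite -(closed_connect clS (connE u v)).
have symE : connect_sym (adjacent E).
  by apply: sym_connect_sym => x y; rewrite /adjacent setUC.
apply: intro_closed => // x y xyE xS.
apply/negPn/negP=> yS; pose e : edge E := exist _ [set x; y] xyE.
move/setP/(_ e): cut0.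
rewrite !inE /= => /negP; apply; apply/cards1P; exists x.
apply/setP=> w; rewrite !inE; case: eqP => [->|_] //=.
by case: eqP => // ->; rewrite (negPf yS).
Qed.

(** * Decomposability and form of the witness *)

Section WCut.
Variables (R : realType) (V : finType) (E : {set {set V}}) (d : nat).
Hypotheses (simpleE : simple_graph E) (d_ge2 : (2 <= d)%N).
Local Notation C := R[i].
Local Notation PhiE := (tensor (fun e : edge E => Phi R d e)).
Local Notation cut_term K := (tensor (fun e : edge E =>
  if e \in K then (d%:R - 1)^-1 *: (1%:M - Phi R d e) else Phi R d e)).

Lemma cut_termE (K : {set edge E}) :
  cut_term K = (d%:R - 1)^-1 ^+ #|K| *:
    tensor (fun e => if e \in K then 1%:M - Phi R d e else Phi R d e).
Proof.
rewrite -prodr_const big_mkcond -tensorZ; apply: eq_tensor=> e.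
by case: ifP => // _; rewrite scale1r.
Qed.

Lemma psd_cut_term (K : {set edge E}) : psd (cut_term K).
Proof.
rewrite cut_termE; apply: psdZ.
  by rewrite exprn_ge0 // invr_ge0 subr_ge0 ler1n ltnW.
apply/psd_projector/tensor_projector=> e; case: ifP => _; last exact: Phi_projector.
exact/projectorC/Phi_projector.
Qed.

Lemma psd_transpose_cut_term (S : {set V}) :
  psd (partial_transpose S (cut_term (cut E S) - PhiE)).
Proof.
rewrite partial_transposeB !partial_transpose_tensor.
(* The projectors and coefficients are chosen simultaneously for all edges. *)
have [pq /fin_all_exists[r /fin_all_exists[s dom]]] :=
  fin_all_exists (fun e => edge_transpose_domination R simpleE d_ge2 e S).
have termE e : edge_transpose S (if e \in cut E S
    then (d%:R - 1)^-1 *: (1%:M - Phi R d e) else Phi R d e) =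
    (r e).1 *: (pq e).1 + (r e).2 *: (pq e).2 by case: (dom e).
have transPhiE e : edge_transpose S (Phi R d e) = (s e).1 *: (pq e).1 + (s e).2 *: (pq e).2.
  by case: (dom e).
have -> := eq_tensor termE; have -> := eq_tensor transPhiE.
by apply: psd_tensorB => e; case: (dom e) => -[? ?] [? ?] [? ?].
Qed.

Lemma W_cut_fully_decomposable :
  connected_graph E -> fully_decomposable (W_cut R E d).
Proof.
move=> connE; split.
  have hPhi : PhiE^t* = PhiE by case: (tensor_projector (Phi_projector R simpleE d_ge2)).
  have [] := psd_sum (fun K (_ : (K \in cut_space E) && (K != set0)) => psd_cut_term K).
  by rewrite !hermsymmxE => /eqP hK _; rewrite adjmxD adjmxN hPhi hK.
move=> S ntS; exists (\sum_(K in cut_space E | (K != set0) && (K != cut E S)) cut_term K).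
(* Partial transposition is an involution, so transposing this Q returns the term of the cut minus
   the product of the Phi's. *)
exists (partial_transpose S (cut_term (cut E S) - PhiE)).
split; [|exact: psd_transpose_cut_term|].
  by apply: psd_sum=> K _; apply: psd_cut_term.
have cutS : (cut E S \in cut_space E) && (cut E S != set0).
  rewrite cut_neq0 // andbT !inE; apply/orP; right.
  by apply/imsetP; exists S; rewrite ?inE.
rewrite partial_transposeK /W_cut (bigD1 (cut E S)) //= addrA addrC.
congr (_ + _); last by rewrite addrC.
by apply: eq_bigl=> K; rewrite andbA.
Qed.

Lemma W_cut_sub_symmetric_form : sub_symmetric_form (W_cut R E d).
Proof.
(* The weight is written in terms of K, the edges carrying 1 - Phi, whereas T in the definition
   collects those carrying Phi; hence the complement. The empty K gets -1. *)
pose w (K : {set edge E}) : R := (d%:R - 1)^-1 ^+ #|K| *+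
  ((K \in cut_space E) && (K != set0)) - (K == set0)%:R.
exists (fun T => w (~: T)).
rewrite (reindex_inj (can_inj (@setCK _))) /=.
under eq_bigr => K _.
  rewrite setCK (_ : tensor _ = 
    tensor (fun e => if e \in K then 1%:M - Phi R d e else Phi R d e)); last first.
    by apply: eq_tensor=> e; rewrite inE; case: (e \in K).
  rewrite rmorphB scalerBl rmorphMn rmorphXn fmorphV rmorphB !rmorph_nat rmorph1 /=.
  over.
rewrite /W_cut sumrB addrC; congr (_ + _).
  rewrite big_mkcond; apply: eq_bigr=> K _.
  by case: ifP => _; rewrite ?mulr0n ?scale0r // mulr1n cut_termE.
rewrite (bigD1 set0) //= eqxx scale1r big1 ?addr0 => [|K /negPf->].
  by congr (- _); apply: eq_tensor=> e; rewrite inE.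
by rewrite scale0r.
Qed.

End WCut.

Theorem mainTheorem6 (R : realType) (V : finType) (E : {set {set V}}) (d : nat)
    (simpleE : simple_graph E) (connectedE : connected_graph E)
    (V_ge2 : (2 <= #|V|)%N) (d_ge2 : (2 <= d)%N) :
  is_SSW (W_cut R E d).
Proof.
split; first exact: W_cut_fully_decomposable.
exact: W_cut_sub_symmetric_form.
Qed.
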